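(* For every finite Abelian group HBL datum $\mathcal{G}=(G,(G_j)_{1\le j\le m},(\phi_j)_{1\le j\le m})$ and every $s=(s_1,\dots,s_m)\in[0,1]^m$, $$\mathbb{B}(\mathcal{G},s)=\mathbb{A}(\mathcal{G},s).$$
   Context: An Abelian group HBL datum is a tuple $\mathcal{G}=(G,(G_j)_{1\le j\le m},(\phi_j)_{1\le j\le m})$ where $m$ is a positive integer, $G$ and $G_j$ are Abelian groups, and $\phi_j:G\to G_j$ are group homomorphisms. It is a finite Abelian group HBL datum if $G$ and all $G_j$ are finite. All groups are discrete and all norms are with respect to counting measure: $\|f\|_{p}=(\sum_x |f(x)|^p)^{1/p}$ for $p\in[1,\infty)$ and $\|f\|_\infty=\sup_x|f(x)|$; when $s_j=0$, $1/s_j=\infty$. $|E|$ denotes the number of elements of a set $E$, and $H\le G$ means that $H$ is a subgroup of $G$. For a finite subgroup $H\le G$ and $s\in[0,1]^m$, define $A(H,s)=|H|\prod_{j=1}^m|\phi_j(H)|^{-s_j}$, and define $\mathbb{A}(\mathcal{G},s)=\sup_{H} A(H,s)$, the supremum being over all finite subgroups $H$ of $G$. $\mathbb{B}(\mathcal{G},s)\in[0,\infty]$ is the infimum of the set of all $C\le\infty$ such that $\sum_{x\in G}\prod_{j=1}^m f_j(\phi_j(x))\le C\prod_{j=1}^m\|f_j\|_{1/s_j}$ for all nonnegative functions $f_j\in L^{1/s_j}(G_j)$. *)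

(* Defs.v *)
From mathcomp Require Import all_boot all_order all_algebra all_fingroup.
From mathcomp Require Import all_classical all_reals all_analysis.

Set Implicit Arguments.
Unset Strict Implicit.
Unset Printing Implicit Defensive.

Import Order.TTheory GRing.Theory Num.Theory.

Local Open Scope classical_set_scope.
Local Open Scope ring_scope.

(* Abelian groups are written additively; for [G : finZmodType], [{group G}]
   is the type of subgroups of [(G, +)]. *)
Record finite_hbl_datum := FiniteHBLDatum {
  hbl_m : nat;
  hbl_m_gt0 : (0 < hbl_m)%N;
  hbl_G : finZmodType;
  hbl_Gj : 'I_hbl_m -> finZmodType;
  hbl_phi : forall j : 'I_hbl_m, {additive hbl_G -> hbl_Gj j}
}.

(* Norm for counting measure on a finite set; only exponents in [1, +oo] are
   meaningful, the value at [-oo] is a dummy. *)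
Definition counting_norm (R : realType) (T : finType) (p : \bar R) (f : T -> R)
    : R :=
  match p with
  | r%:E => (\sum_(x : T) `|f x| `^ r) `^ r^-1
  | +oo%E => sup (range (fun x : T => `|f x|))
  | -oo%E => 0
  end.

Definition hbl_A_sub (R : realType) (D : finite_hbl_datum)
    (H : {group hbl_G D}) (s : 'I_(hbl_m D) -> R) : R :=
  #|H|%:R * \prod_(j < hbl_m D) #|hbl_phi j @: H|%:R `^ (- s j).

(* Every subgroup of a finite group is finite, so the supremum is over all
   subgroups. *)
Definition hbl_A (R : realType) (D : finite_hbl_datum)
    (s : 'I_(hbl_m D) -> R) : \bar R :=
  ereal_sup (range (fun H : {group hbl_G D} => (hbl_A_sub H s)%:E)).

(* The inverse in [\bar R] satisfies [0^-1 = +oo], so [(s j)%:E^-1] is the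
   exponent [1/s_j], with [1/0 = +oo].  On a finite group every real-valued
   function belongs to every L^p. *)
Definition hbl_ineq (R : realType) (D : finite_hbl_datum)
    (s : 'I_(hbl_m D) -> R) (C : \bar R) : Prop :=
  forall f : forall j : 'I_(hbl_m D), hbl_Gj j -> R,
    (forall j y, 0 <= f j y) ->
    ((\sum_(x : hbl_G D) \prod_(j < hbl_m D) f j (hbl_phi j x))%:E <=
     C * (\prod_(j < hbl_m D) counting_norm ((s j)%:E^-1) (f j))%:E)%E.

Definition hbl_B (R : realType) (D : finite_hbl_datum)
    (s : 'I_(hbl_m D) -> R) : \bar R :=
  ereal_inf [set C : \bar R | (0 <= C)%E /\ hbl_ineq s C].

(* Main.v *)
Require Import Defs.
From mathcomp Require Import all_boot all_order all_algebra all_fingroup.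
From mathcomp Require Import all_classical all_reals all_analysis.
From mathcomp Require Import ring lra.
Import Order.TTheory GRing.Theory Num.Theory.
Local Open Scope ring_scope.

Set Implicit Arguments.
Unset Strict Implicit.
Unset Printing Implicit Defensive.

(** Why the optimal constant is the supremum over subgroups.

    The indicator functions of the sets [phi_j(H)] give the lower bound
    ([hbl_ineq_bound]).  For the upper bound, substituting [f_j = h_j ^ s_j]
    turns the inequality into

      [sum_x prod_j h_j(phi_j x) ^ s_j <= C * prod_j (sum_y h_j y) ^ s_j],

    and for fixed [h] the logarithm of the left side is convex in [s] by
    Hoelder, while [ln |H| - sum_j s_j ln |phi_j(H)|] is affine in [s] for each
    [H].  So wherever one fixed [W] attains the supremum over subgroups, the
    inequality at an interior point of a segment follows from the inequality at
    the two ends ([hbl_between_interpolate]).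

    The induction is over pairs of subgroups [U <= V] ([hbl_between]): [x] runs
    over [V], the [h_j] are invariant under [phi_j(U)], and only the subgroups
    between [U] and [V] count in the supremum.  This encodes the inequality on
    [V / U] without forming quotients.  Three cases are settled directly or by
    the induction hypothesis for shorter intervals:

    - A maximizer [H] lies strictly between [U] and [V].  Summing first over
      cosets of [H] and then over [V] composes the inequalities for [(U, H)]
      and [(H, V)] without loss, because both constants are the ratio of [H]
      ([hbl_between_factor]).
    - Some [s_i = 1].  The left side is additive in [h_i], so it suffices to sum
      over the part of [V] that [phi_i] maps into a coset of [phi_i(U)]
      ([hbl_between_exponent1]).
    - All exponents but one are 0, or belong to some [j] with
      [phi_j(V) = phi_j(U)].  What is left is Jensen's inequality for a single
      function ([hbl_between_base]).

    Otherwise two exponents [s_i], [s_k] lie strictly between 0 and 1 and only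
    [U] and [V] can be maximizers.  Along some nonzero direction supported on
    [{i, k}] the quotient of the ratios of [U] and [V] does not change
    ([two_point_kernel]).  Slide [s] along it both ways until an intermediate
    subgroup becomes a maximizer or a coordinate reaches 0 or 1
    ([slide_to_boundary]): the first event is the factorization case, the second
    lowers the number of fractional exponents, and interpolating between the
    two stopping points gives the inequality at [s]. *)

(** * Inequalities for real powers *)

Section RealInequalities.
Variable R : realType.

Lemma weighted_amgm (a b t : R) : 0 < a -> 0 < b -> 0 <= t <= 1 ->
  a `^ t * b `^ (1 - t) <= t * a + (1 - t) * b.
Proof.
move=> a0 b0 /andP[t0 t1].
set g := t * ln a + (1 - t) * ln b.
have -> : a `^ t * b `^ (1 - t) = expR g.
  by rewrite /powR !gt_eqF// -expRD.
(* The tangent line of [exp] at [g] lies below its graph at [ln c]. *)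
have tangent (c : R) : 0 < c -> expR g * (1 + (ln c - g)) <= c.
  move=> c0; rewrite -[leRHS]lnK ?posrE//.
  rewrite -[in leRHS](subrK g (ln c)) (expRD (ln c - g)) [leLHS]mulrC.
  by rewrite ler_pM2r ?expR_gt0// expR_ge1Dx.
apply: le_trans (lerD (ler_wpM2l t0 (tangent a a0))
  (ler_wpM2l _ (tangent b b0))); last by rewrite subr_ge0.
by rewrite le_eqVlt; apply/orP; left; apply/eqP; rewrite /g; ring.
Qed.

(** Hoelder's inequality for the exponents [1 / t] and [1 / (1 - t)], with the
    two sums replaced by upper bounds: term by term it is the weighted AM-GM
    inequality for [P x / X] and [Q x / Y]. *)
Lemma sum_powR_hoelder (T : finType) (S : {set T}) (P Q : T -> R) (X Y t : R) :
    (forall x, x \in S -> 0 <= P x) -> (forall x, x \in S -> 0 <= Q x) ->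
    0 <= t <= 1 -> \sum_(x in S) P x <= X -> \sum_(x in S) Q x <= Y ->
  \sum_(x in S) P x `^ t * Q x `^ (1 - t) <= X `^ t * Y `^ (1 - t).
Proof.
move=> P0 Q0 t01 PX QY; have /andP[t0 t1] := t01.
have X0 : 0 <= X by apply: le_trans PX; apply: sumr_ge0.
have Y0 : 0 <= Y by apply: le_trans QY; apply: sumr_ge0.
have [->|tn0] := eqVneq t 0.
  rewrite powRr0 mul1r subr0 powRr1//; apply: le_trans QY.
  by apply: ler_sum => x xS; rewrite powRr0 mul1r powRr1// Q0.
have [->|tn1] := eqVneq t 1.
  rewrite subrr powRr0 mulr1 powRr1//; apply: le_trans PX.
  by apply: ler_sum => x xS; rewrite powRr0 mulr1 powRr1// P0.
have vanish (F : T -> R) : (forall x, x \in S -> 0 <= F x) ->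
    \sum_(x in S) F x <= 0 -> forall x, x \in S -> F x = 0.
  move=> F0 s0 x xS; apply/eqP; rewrite eq_le F0// andbT.
  by apply: le_trans s0; rewrite (bigD1 x)//= lerDl sumr_ge0// => y /andP[/F0].
have rhs0 : 0 <= X `^ t * Y `^ (1 - t) by rewrite mulr_ge0 ?powR_ge0.
have [X00|Xn0] := eqVneq X 0.
  rewrite X00 in PX; rewrite big1// => x xS.
  by rewrite (vanish P P0 PX x xS) powR0// mul0r.
have [Y00|Yn0] := eqVneq Y 0.
  rewrite Y00 in QY; rewrite big1// => x xS; rewrite (vanish Q Q0 QY x xS).
  by rewrite (@powR0 _ (1 - t)) ?mulr0// subr_eq0 eq_sym.
have Xp : 0 < X by rewrite lt_def Xn0.
have Yp : 0 < Y by rewrite lt_def Yn0.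
pose c := X `^ t * Y `^ (1 - t).
have term x : x \in S ->
    P x `^ t * Q x `^ (1 - t) <= c * (t * (P x / X) + (1 - t) * (Q x / Y)).
  move=> xS; have Px := P0 x xS; have Qx := Q0 x xS.
  have r0 : 0 <= c * (t * (P x / X) + (1 - t) * (Q x / Y)).
    by rewrite mulr_ge0// addr_ge0// mulr_ge0// ?subr_ge0// divr_ge0.
  have [Px0|Pn0] := eqVneq (P x) 0; first by rewrite {1}Px0 powR0// mul0r.
  have [Qx0|Qn0] := eqVneq (Q x) 0.
    by rewrite {1}Qx0 [X in _ * X]powR0 ?mulr0// subr_eq0 eq_sym.
  have P_gt0 : 0 < P x by rewrite lt_def Pn0.
  have Q_gt0 : 0 < Q x by rewrite lt_def Qn0.
  have scaleE (z Z u : R) : 0 < z -> 0 < Z -> z `^ u = Z `^ u * (z / Z) `^ u.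
    by move=> z0 Z0; rewrite -powRM ?divr_ge0 ?ltW// mulrC divfK// gt_eqF.
  rewrite (scaleE (P x) X)// (scaleE (Q x) Y)// mulrACA ler_wpM2l//.
  by rewrite weighted_amgm// divr_gt0.
apply: le_trans (ler_sum _ term) _; rewrite -mulr_sumr -[leRHS]mulr1.
rewrite ler_wpM2l// big_split/= -!mulr_sumr -!mulr_suml.
have : \sum_(x in S) P x / X <= 1 by rewrite -mulr_suml ler_pdivrMr// mul1r.
have : \sum_(x in S) Q x / Y <= 1 by rewrite -mulr_suml ler_pdivrMr// mul1r.
rewrite -!mulr_suml => qy px.
have : 0 <= 1 - t by rewrite subr_ge0.
nra.
Qed.

(** With nonnegative exponents this holds at [x = 0] too, where [0 `^ 0 = 1];
    so functions with zeros need no separate treatment in the interpolation. *)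
Lemma powR_convex_exponent (x a b t : R) : 0 <= a -> 0 <= b -> 0 < t < 1 ->
  x `^ (t * a + (1 - t) * b) = (x `^ a) `^ t * (x `^ b) `^ (1 - t).
Proof.
move=> a0 b0 /andP[t0 t1]; rewrite -!powRrM mulrC [b * _]mulrC.
have t1' : 0 < 1 - t by rewrite subr_gt0.
have [ab|ab] := eqVneq (t * a + (1 - t) * b) 0.
  suff [-> ->] : a = 0 /\ b = 0 by rewrite !mulr0 mul0r addr0 powRr0 mulr1.
  have := mulr_ge0 (ltW t0) a0; have := mulr_ge0 (ltW t1') b0.
  by split; nra.
by rewrite [a * t]mulrC powRD// (negPf ab).
Qed.

Lemma powR_prod (T : finType) (F : T -> R) (t : R) : (forall x, 0 <= F x) ->
  (\prod_x F x) `^ t = \prod_x F x `^ t.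
Proof.
move=> F0.
suff [] : 0 <= \prod_x F x /\ (\prod_x F x) `^ t = \prod_x F x `^ t by [].
elim/big_ind2 : _ => [|_ x _ y [x0 <-] [y0 <-]|//].
  by rewrite powR1.
by rewrite mulr_ge0// powRM.
Qed.

End RealInequalities.

(** Finitely many affine functions of [t], all positive at 0 and one of them
    decreasing: the first time at which one of them vanishes. *)
Lemma first_zero_affine (R : realFieldType) (T : finType) (P : pred T)
    (a b : T -> R) :
    (forall x, P x -> 0 < a x) -> (exists2 x, P x & b x < 0) ->
  exists2 t, 0 < t & (forall x, P x -> 0 <= a x + t * b x) /\
                     exists2 x, P x & a x + t * b x = 0.
Proof.
move=> a0 [x0 Px0 bx0].
have Q0 : P x0 && (b x0 < 0) by rewrite Px0.
(* The time at which the decreasing function [a x + t * b x] vanishes. *)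
pose F x := a x / - b x.
case: (@arg_minP _ _ _ x0 (fun x => P x && (b x < 0)) F Q0).
move=> x /andP[Px bx] xmin.
have nbx : 0 < - b x by rewrite oppr_gt0.
exists (F x); first by rewrite divr_gt0// a0.
split; last by exists x => //; rewrite /F; field; rewrite lt_eqF.
have Fx0 : 0 < F x by rewrite divr_gt0// a0.
move=> y Py; have [by0|by0] := leP 0 (b y).
  by apply: addr_ge0; [exact/ltW/a0 | exact: mulr_ge0 (ltW Fx0) _].
have := xmin y; rewrite Py by0 => /(_ isT).
by rewrite {2}/F ler_pdivlMr ?oppr_gt0// => h; rewrite -lerBlDr; lra.
Qed.

(** * Averaging over cosets *)

Section GroupSums.
Variables (R : pzSemiRingType) (gT : finGroupType).
Implicit Types H V : {group gT}.

Lemma sum_translate V (F : gT -> R) x : x \in V ->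
  \sum_(y in V) F (x * y)%g = \sum_(y in V) F y.
Proof.
move=> xV; rewrite [RHS](reindex_inj (mulgI x)).
by apply: eq_bigl => y; rewrite groupMl.
Qed.

Lemma sum_translater V (F : gT -> R) x : x \in V ->
  \sum_(y in V) F (y * x)%g = \sum_(y in V) F y.
Proof.
move=> xV; rewrite [RHS](reindex_inj (mulIg x)).
by apply: eq_bigl => y; rewrite groupMr.
Qed.

Lemma sum_group_average H V (F : gT -> R) : H \subset V ->
  \sum_(x in V) \sum_(y in H) F (x * y)%g = #|H|%:R * \sum_(x in V) F x.
Proof.
move=> /fintype.subsetP HV; rewrite exchange_big/=.
rewrite (eq_bigr (fun=> \sum_(x in V) F x)); last first.
  by move=> y /HV yV; rewrite sum_translater.
by rewrite sumr_const mulr_natl.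
Qed.

End GroupSums.

(** All fibres of a morphism have the same cardinality; the proof evaluates the
    double sum of [F (f x * y)] over [V] and [f @* V] in both orders. *)
Lemma sum_morphim (R : pzSemiRingType) (gT rT : finGroupType)
    (f : {morphism [set: gT] >-> rT}) (V : {group gT}) (F : rT -> R) :
  #|(f @* V)%g|%:R * \sum_(x in V) F (f x) =
  #|V|%:R * \sum_(y in (f @* V)%g) F y.
Proof.
have fV x : x \in V -> f x \in (f @* V)%g.
  by move=> xV; rewrite mem_morphim ?inE.
transitivity (\sum_(x in V) \sum_(y in (f @* V)%g) F (f x * y)%g); last first.
  rewrite (eq_bigr (fun=> \sum_(y in (f @* V)%g) F y)).
    by rewrite sumr_const mulr_natl.
  by move=> x xV; rewrite (sum_translate _ (fV x xV)).
rewrite exchange_big/= [RHS](eq_bigr (fun=> \sum_(x in V) F (f x))).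
  by rewrite sumr_const mulr_natl.
move=> _ /morphimP[y _ yV ->].
rewrite -(sum_translater (F \o f) yV).
by apply: eq_bigr => x _ /=; rewrite morphM ?inE.
Qed.

Lemma sum_indicator (R : pzSemiRingType) (T : finType) (A B : {set T}) :
  \sum_(x in A) (x \in B)%:R = #|A :&: B|%:R :> R.
Proof.
rewrite -natr_sum -sum1_card; congr (_%:R).
rewrite (eq_bigl _ _ (fun x => finset.in_setI x A B)) big_mkcondr.
by apply: eq_bigr => x _; case: (x \in B).
Qed.

Lemma card_group_gt0 (R : numDomainType) (hT : finGroupType) (H : {group hT}) :
  0 < #|H|%:R :> R.
Proof. by rewrite ltr0n cardG_gt0. Qed.

(** * The inequality between two subgroups *)

Section SubgroupIntervals.
Variables (R : realType) (I : finType) (gT : finGroupType).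
Variables (rT : I -> finGroupType).
Variable phi : forall j, {morphism [set: gT] >-> rT j}.
Implicit Types (U H K V W : {group gT}) (s : I -> R).

Local Notation img j H := (phi j @* H)%g.

Definition subgroup_ratio s (H : {set gT}) : R :=
  #|H|%:R * \prod_j #|img j H|%:R `^ (- s j).

(** The inequality for the quotient [V / U]: functions on [phi_j(V) / phi_j(U)]
    become functions invariant under [phi_j(U)].  Replacing all cardinalities
    and sums by those of the quotients would divide both sides by [|U|]. *)
Definition hbl_between s U V : Prop :=
  forall (h : forall j, rT j -> R) (C : R),
    (forall j y, 0 <= h j y) ->
    (forall j y z, z \in img j U -> h j (y * z)%g = h j y) ->
    (forall H, U \subset H -> H \subset V -> subgroup_ratio s H <= C) ->
  \sum_(x in V) \prod_j h j (phi j x) `^ s j <=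
  C * \prod_j (\sum_(y in img j V) h j y) `^ s j.

Lemma subgroup_ratio_gt0 s H : 0 < subgroup_ratio s H.
Proof.
rewrite mulr_gt0 ?card_group_gt0//; apply: prodr_gt0 => j _.
by rewrite powR_gt0// card_group_gt0.
Qed.

Lemma subgroup_ratio_mul_prod s H :
  subgroup_ratio s H * \prod_j #|img j H|%:R `^ s j = #|H|%:R.
Proof.
rewrite -mulrA -big_split/= big1 ?mulr1// => j _.
by rewrite powRN mulVf// gt_eqF// powR_gt0// card_group_gt0.
Qed.

Lemma hbl_between_translate s U V (h : forall j, rT j -> R) (C : R) x :
    hbl_between s U V -> (forall j y, 0 <= h j y) ->
    (forall j y z, z \in img j U -> h j (y * z)%g = h j y) ->
    (forall H, U \subset H -> H \subset V -> subgroup_ratio s H <= C) ->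
  \sum_(y in V) \prod_j h j (phi j (x * y)%g) `^ s j <=
  C * \prod_j (\sum_(z in img j V) h j (phi j x * z)%g) `^ s j.
Proof.
move=> hUV h0 hU hC.
rewrite (eq_bigr (fun y => \prod_j h j (phi j x * phi j y)%g `^ s j)); last first.
  by move=> y _; apply: eq_bigr => j _; rewrite morphM ?inE.
apply: (hUV (fun j y => h j (phi j x * y)%g)) => // j y z zU.
by rewrite mulgA hU.
Qed.

(** Sum over each coset of [H] in [V] with the inequality for [(U, H)], which
    replaces [h j] by its sums [k j] over cosets of [phi_j(H)]; then apply the
    inequality for [(H, V)] to [k].  By maximality both constants are the ratio
    of [H].  Every point is counted [|H|] times, and [|H|] is the ratio of [H]
    times the factors [|phi_j(H)| ^ s_j] produced by the sums of [k], so one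
    of the two constants cancels. *)
Lemma hbl_between_factor s U H V :
    U \subset H -> H \subset V ->
    (forall K, U \subset K -> K \subset V ->
       subgroup_ratio s K <= subgroup_ratio s H) ->
  hbl_between s U H -> hbl_between s H V -> hbl_between s U V.
Proof.
move=> UH HV Hmax hUH hHV h C h0 hU hC.
pose A := subgroup_ratio s H.
have A0 : 0 <= A by exact/ltW/subgroup_ratio_gt0.
pose k j y := \sum_(z in img j H) h j (y * z)%g.
have k0 j y : 0 <= k j y by apply: sumr_ge0.
pose T := \prod_j (\sum_(y in img j V) h j y) `^ s j.
have T0 : 0 <= T by apply: prodr_ge0 => j _; exact: powR_ge0.
have cH := card_group_gt0 R H.
rewrite -(ler_pM2l cH) -sum_group_average//.
have coset x : x \in V ->
    \sum_(y in H) \prod_j h j (phi j (x * y)%g) `^ s j <=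
    A * \prod_j k j (phi j x) `^ s j.
  move=> _; apply: (hbl_between_translate _ hUH) => // K UK KH.
  by apply: Hmax => //; exact: fintype.subset_trans KH HV.
apply: le_trans (ler_sum _ coset) _; rewrite -mulr_sumr.
have : \sum_(x in V) \prod_j k j (phi j x) `^ s j <=
    A * \prod_j (\sum_(y in img j V) k j y) `^ s j.
  apply: hHV => // [j y z zH|K HK KV]; last first.
    by apply: Hmax => //; exact: fintype.subset_trans UH HK.
  rewrite /k -[RHS](sum_translate (fun w => h j (y * w)%g) zH).
  by apply: eq_bigr => w _; rewrite mulgA.
have -> : \prod_j (\sum_(y in img j V) k j y) `^ s j =
    (\prod_j #|img j H|%:R `^ s j) * T.
  rewrite -big_split/=; apply: eq_bigr => j _.
  by rewrite sum_group_average ?morphimS// powRM// sumr_ge0.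
move=> /(ler_wpM2l A0) /le_trans; apply.
have -> : A * (A * (\prod_j #|img j H|%:R `^ s j * T)) = #|H|%:R * (A * T).
  by rewrite -(subgroup_ratio_mul_prod s H) -/A; ring.
by rewrite ler_pM2l// ler_wpM2r// hC.
Qed.

(** When [s i = 1] the left side is additive in [h i], so it can be split
    according to the coset of [phi_i(U)] that contains [phi_i x].  On one coset
    [h i] is constant, and the sum runs over a translate of the subgroup [K] of
    the points of [V] mapped into [phi_i(U)]; the other functions are bounded by
    their full sums. *)
Lemma hbl_between_exponent1 s U V i :
    (forall j, 0 <= s j) -> s i = 1 -> U \subset V ->
    hbl_between s U (V :&: phi i @*^-1 (phi i @* U))%G ->
  hbl_between s U V.
Proof.
move=> s0 si UV; set K := (V :&: _)%G => hUK h C h0 hU hC.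
have KV : K \subset V by exact: subsetIl.
have imgK : img i K = img i U.
  by rewrite morphim_setIpre; apply/finset.setIidPr/morphimS.
(* The fibres of [phi i] over its image have the same size in [K] as in [V]. *)
have cV : (#|img i V|%:R * #|K|%:R = #|V|%:R * #|img i K|%:R :> R).
  have := sum_morphim (phi i) V (fun y => (y \in img i U)%:R : R).
  rewrite sum_indicator (finset.setIidPr (morphimS _ UV)) imgK => <-.
  rewrite -sum_indicator; congr (_ * _).
  by apply: eq_bigr => x xV; rewrite !inE.
pose T j := \sum_(y in img j V) h j y.
have T0 j : 0 <= T j by apply: sumr_ge0.
have C0 : 0 <= C.
  by apply: le_trans (hC V UV (fintype.subxx _)); exact/ltW/subgroup_ratio_gt0.
pose P := \prod_(j | j != i) T j `^ s j.
have cK := card_group_gt0 R K; have cimg := card_group_gt0 R (phi i @* V)%G.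
have coset x : x \in V ->
    \sum_(y in K) \prod_j h j (phi j (x * y)%g) `^ s j <=
    C * (#|img i K|%:R * P) * h i (phi i x).
  move=> xV; have xjV j : phi j x \in img j V by rewrite mem_morphim ?inE.
  have hCK H : U \subset H -> H \subset K -> subgroup_ratio s H <= C.
    by move=> UH HK; apply: hC => //; exact: fintype.subset_trans HK KV.
  apply: le_trans (hbl_between_translate x hUK h0 hU hCK) _.
  rewrite -mulrA ler_wpM2l// (bigD1 i)//= si powRr1 ?sumr_ge0//.
  rewrite (eq_bigr (fun=> h i (phi i x))); last first.
    by move=> y; rewrite imgK; exact: hU.
  rewrite sumr_const -[X in X * _ <= _]mulr_natl [leLHS]mulrAC.
  rewrite ler_wpM2r// ler_wpM2l//.
  apply: ler_prod => j _; rewrite powR_ge0/= ge0_ler_powR// ?nnegrE ?sumr_ge0//.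
  rewrite /T -(sum_translate _ (xjV j)).
  rewrite [leRHS](bigID [in img j K])/= -[leLHS]addr0 lerD ?sumr_ge0//.
  rewrite le_eqVlt; apply/orP; left; apply/eqP; apply: eq_bigl => z.
  by rewrite andb_idl// => /(fintype.subsetP (morphimS _ KV)).
have UK : U \subset K.
  rewrite finset.subsetI UV; apply/fintype.subsetP => x xU.
  by rewrite !inE mem_morphim ?inE.
rewrite -(ler_pM2l cK) -sum_group_average//.
apply: le_trans (ler_sum _ coset) _; rewrite -mulr_sumr.
rewrite -(ler_pM2l cimg).
have := sum_morphim (phi i) V (h i); rewrite -/(T i) => e.
rewrite le_eqVlt; apply/orP; left; apply/eqP.
rewrite (bigD1 i)//= -/(T i) si powRr1// -/P mulrCA e.
transitivity (C * P * T i * (#|V|%:R * #|img i K|%:R)); first by ring.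
by rewrite -cV; ring.
Qed.

(** For [j != i0] the factor is constant along [V]: either its exponent is 0, or
    [h j] is constant on [phi_j(V) = phi_j(U)].  Jensen's inequality bounds
    the factor of [i0], and the resulting constant is the ratio of [V]. *)
Lemma hbl_between_base s U V i0 :
    0 <= s i0 <= 1 ->
    (forall j, j != i0 -> s j = 0 \/ img j V \subset img j U) ->
    U \subset V ->
  hbl_between s U V.
Proof.
move=> /andP[si0 si1] triv UV h C h0 hU hC.
pose T j := \sum_(y in img j V) h j y.
have T0 j : 0 <= T j by apply: sumr_ge0.
pose c j := #|img j V|%:R : R.
have c0 j : 0 < c j by exact: card_group_gt0.
have factorE j x : x \in V -> j != i0 ->
    h j (phi j x) `^ s j = c j `^ (- s j) * T j `^ s j.
  move=> xV /triv[->|/fintype.subsetP VU].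
    by rewrite oppr0 !powRr0 mulr1.
  have -> : T j = c j * h j (phi j x).
    have xjV : phi j x \in img j V by rewrite mem_morphim ?inE.
    rewrite /T -(sum_translate _ xjV).
    rewrite (eq_bigr (fun=> h j (phi j x))); last by move=> y /VU/hU.
    by rewrite sumr_const mulr_natl.
  rewrite powRM ?(ltW (c0 _))// mulrA powRN mulVf ?mul1r//.
  by rewrite gt_eqF// powR_gt0.
(* Hoelder against the constant 1, moved from [phi_i0(V)] to [V]. *)
have sum_i0 : \sum_(x in V) h i0 (phi i0 x) `^ s i0 <=
    #|V|%:R * c i0 `^ (- s i0) * T i0 `^ s i0.
  rewrite -(ler_pM2l (c0 i0)) (sum_morphim _ _ (fun y => h i0 y `^ s i0)).
  have : \sum_(y in img i0 V) h i0 y `^ s i0 * 1 `^ (1 - s i0) <=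
      T i0 `^ s i0 * c i0 `^ (1 - s i0).
    apply: sum_powR_hoelder => //; rewrite ?si0//.
    by rewrite sumr_const.
  rewrite [c i0 `^ _]powRD; last by rewrite (gt_eqF (c0 i0)) implybT.
  rewrite powRr1 ?(ltW (c0 _))//.
  under eq_bigr do rewrite powR1 mulr1.
  move=> /(ler_wpM2l (ltW (card_group_gt0 _ V))) /le_trans; apply.
  by rewrite le_eqVlt; apply/orP; left; apply/eqP; ring.
rewrite (eq_bigr (fun x => h i0 (phi i0 x) `^ s i0 *
    \prod_(j | j != i0) (c j `^ (- s j) * T j `^ s j))); last first.
  move=> x xV; rewrite (bigD1 i0)//=; congr (_ * _).
  by apply: eq_bigr => j /(factorE _ _ xV).
rewrite -mulr_suml.
have P0 : 0 <= \prod_(j | j != i0) (c j `^ (- s j) * T j `^ s j).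
  by apply: prodr_ge0 => j _; rewrite mulr_ge0 ?powR_ge0.
apply: le_trans (ler_wpM2r P0 sum_i0) _.
apply: le_trans (ler_wpM2r _ (hC V UV (fintype.subxx _))); last first.
  by apply: prodr_ge0 => j _; exact: powR_ge0.
rewrite /subgroup_ratio -[leRHS]mulrA -big_split/= [in leRHS](bigD1 i0)//=.
by rewrite !mulrA.
Qed.

(** * Moving the exponents *)

Definition log_ratio s (H : {set gT}) : R :=
  ln #|H|%:R - \sum_j s j * ln #|img j H|%:R.

Definition ratio_maximizer s U V W : Prop :=
  [/\ U \subset W, W \subset V &
      forall H, U \subset H -> H \subset V -> log_ratio s H <= log_ratio s W].

Lemma subgroup_ratioE s H : subgroup_ratio s H = expR (log_ratio s H).
Proof.
rewrite expRD lnK ?posrE ?card_group_gt0// -sumrN expR_sum; congr (_ * _).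
apply: eq_bigr => j _; rewrite /powR gt_eqF ?mulNr//.
exact: card_group_gt0.
Qed.

Lemma log_ratio_shift s d (t : R) (H : {set gT}) :
  log_ratio (fun j => s j + t * d j) H =
  log_ratio s H - t * \sum_j d j * ln #|img j H|%:R.
Proof.
rewrite /log_ratio mulr_sumr -addrA -opprD -big_split/=; congr (_ - _).
by apply: eq_bigr => j _; rewrite mulrDl mulrA.
Qed.

(** For fixed [h] the left side of the inequality is log-convex in the
    exponents, whereas the bound with constant the ratio of [W] is log-affine;
    so the bound passes from the ends of a segment to its points, provided the
    same [W] is maximal at both ends. *)
Lemma hbl_between_interpolate s s1 s2 (t : R) U V W :
    0 < t < 1 -> (forall j, 0 <= s1 j) -> (forall j, 0 <= s2 j) ->
    (forall j, s j = t * s1 j + (1 - t) * s2 j) ->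
    ratio_maximizer s1 U V W -> ratio_maximizer s2 U V W ->
    hbl_between s1 U V -> hbl_between s2 U V ->
  hbl_between s U V.
Proof.
move=> t01 s10 s20 sE [UW WV max1] [_ _ max2] h1 h2 h C h0 hU hC.
have /andP[t0 t1] := t01.
pose T j := \sum_(y in img j V) h j y.
have T0 j : 0 <= T j by apply: sumr_ge0.
have split_prod (y : I -> R) : (forall j, 0 <= y j) ->
    \prod_j y j `^ s j =
    (\prod_j y j `^ s1 j) `^ t * (\prod_j y j `^ s2 j) `^ (1 - t).
  move=> y0; rewrite !powR_prod; try by move=> j; exact: powR_ge0.
  rewrite -big_split/=; apply: eq_bigr => j _.
  by rewrite sE powR_convex_exponent.
rewrite (eq_bigr (fun x => (\prod_j h j (phi j x) `^ s1 j) `^ t *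
                  (\prod_j h j (phi j x) `^ s2 j) `^ (1 - t))); last first.
  by move=> x _; rewrite split_prod.
have ratio_le s' : (forall H, U \subset H -> H \subset V ->
      log_ratio s' H <= log_ratio s' W) ->
    forall H, U \subset H -> H \subset V ->
      subgroup_ratio s' H <= subgroup_ratio s' W.
  by move=> m H UH HV; rewrite !subgroup_ratioE ler_expR m.
have b1 := h1 h _ h0 hU (ratio_le _ max1).
have b2 := h2 h _ h0 hU (ratio_le _ max2).
have prod0 s' x : 0 <= \prod_j h j (phi j x) `^ s' j.
  by apply: prodr_ge0 => j _; exact: powR_ge0.
have := sum_powR_hoelder (fun x _ => prod0 s1 x) (fun x _ => prod0 s2 x) _ b1 b2.
move=> /(_ t); rewrite (ltW t0) (ltW t1) => /(_ isT) /le_trans; apply.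
have prodT0 s' : 0 <= \prod_j T j `^ s' j.
  by apply: prodr_ge0 => j _; exact: powR_ge0.
have ratio0 s' : 0 <= subgroup_ratio s' W by exact/ltW/subgroup_ratio_gt0.
rewrite (powRM _ (ratio0 s1) (prodT0 s1)) (powRM _ (ratio0 s2) (prodT0 s2)).
rewrite [leLHS]mulrACA -(split_prod T T0) ler_wpM2r//.
apply: le_trans (hC W UW WV); rewrite !subgroup_ratioE -!expRM -expRD ler_expR.
rewrite le_eqVlt; apply/orP; left; apply/eqP; rewrite /log_ratio.
rewrite [X in _ = _ - X](eq_bigr (fun j => t * (s1 j * ln #|img j W|%:R) +
                   (1 - t) * (s2 j * ln #|img j W|%:R))); last first.
  by move=> j _; rewrite sE; ring.
by rewrite big_split/= -!mulr_sumr; ring.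
Qed.

Definition fractional s : {set I} := [set j | 0 < s j < 1].

(** The gap between [W] and each intermediate subgroup, and the distances of the
    moving coordinates to 0 and 1, are affine in the time [t] and positive at
    [t = 0]; stop at the first zero among them.  Until then [W] stays maximal:
    intermediate subgroups are controlled by the gaps, and the endpoint other
    than [W] by the equality of slopes. *)
Lemma slide_to_boundary s d U V W :
    (forall j, 0 <= s j <= 1) ->
    ratio_maximizer s U V W -> W = U \/ W = V ->
    (forall H, U \subset H -> H \subset V -> H != U -> H != V ->
       log_ratio s H < log_ratio s W) ->
    (forall j, d j != 0 -> j \in fractional s) -> (exists j, d j != 0) ->
    \sum_j d j * ln #|img j U|%:R = \sum_j d j * ln #|img j V|%:R :> R ->
  exists2 t, 0 < t & let s' := fun j => s j + t * d j in
    [/\ forall j, 0 <= s' j <= 1, ratio_maximizer s' U V W &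
     (exists H, [/\ U \subset H, H \subset V, H != U, H != V &
                    log_ratio s' H = log_ratio s' W]) \/
     (#|fractional s'| < #|fractional s|)%N].
Proof.
move=> s01 [UW WV Wmax] WUV strict dfrac [j0 dj0] slopeUV.
pose slope (H : {set gT}) := \sum_j d j * ln #|img j H|%:R : R.
(* The constraints: gaps, and (with [true], [false]) distances to 0 and 1. *)
pose P (x : {group gT} + I * bool) := match x with
  | inl H => [&& U \subset H, H \subset V, H != U & H != V]
  | inr jb => d jb.1 != 0 end.
pose a (x : {group gT} + I * bool) := match x with
  | inl H => log_ratio s W - log_ratio s H
  | inr (j, b) => if b then s j else 1 - s j end.
pose b (x : {group gT} + I * bool) := match x with
  | inl H => slope H - slope W
  | inr (j, b) => if b then d j else - d j end.
have a0 x : P x -> 0 < a x.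
  case: x => [H /and4P[UH HV HU HV']|[j [] /= /dfrac]].
  - by rewrite subr_gt0 strict.
  - by rewrite inE => /andP[].
  - by rewrite inE subr_gt0 => /andP[].
have b0 : exists2 x, P x & b x < 0.
  have [dj|dj|dj] := ltgtP (d j0) 0; last by rewrite dj eqxx in dj0.
  - by exists (inr (j0, true)).
  - by exists (inr (j0, false)) => //=; rewrite oppr_lt0.
have [t t0 [nonneg [x Px x0]]] := first_zero_affine a0 b0.
exists t => // s'.
have s'0 j : d j = 0 -> s' j = s j by rewrite /s' => ->; rewrite mulr0 addr0.
have s'01 j : 0 <= s' j <= 1.
  have [/s'0 ->//|dj] := eqVneq (d j) 0.
  have := nonneg (inr (j, true)) dj; have := nonneg (inr (j, false)) dj.
  by rewrite /= /s'; lra.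
have logE H : log_ratio s' H = log_ratio s H - t * slope H.
  exact: log_ratio_shift.
split => //.
  split => // H UH HV; rewrite !logE.
  have endpoint : slope H = slope W ->
      log_ratio s H - t * slope H <= log_ratio s W - t * slope W.
    by move=> ->; rewrite lerD2r Wmax.
  have [HU|HU] := eqVneq H U.
    by apply: endpoint; case: WUV => ->; rewrite HU.
  have [HV'|HV'] := eqVneq H V.
    by apply: endpoint; case: WUV => ->; rewrite HV'.
  have := nonneg (inl H); rewrite /= UH HV HU HV' => /(_ isT).
  by lra.
case: x Px x0 => [H /and4P[UH HV HU HV'] /= e|[j c] /= dj e].
  left; exists H; split => //; rewrite !logE; lra.
right; apply: proper_card; rewrite properE; apply/andP; split.
  apply/fintype.subsetP => i; rewrite !inE.
  have [/s'0 ->//|di _] := eqVneq (d i) 0.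
  by have := dfrac i di; rewrite inE.
apply/negP => /fintype.subsetP /(_ j (dfrac j dj)); rewrite inE => /andP[].
by case: c e; rewrite /s' => e; lra.
Qed.

Lemma two_point_kernel (alpha : I -> R) i k : i != k ->
  exists d : I -> R, [/\ forall j, d j != 0 -> (j == i) || (j == k),
    exists j, d j != 0 & \sum_j d j * alpha j = 0].
Proof.
move=> ik; have [ai|ai] := eqVneq (alpha i) 0.
  exists (fun j => (j == i)%:R); split.
  - by move=> j; case: (j == i) => //; rewrite eqxx.
  - by exists i; rewrite eqxx oner_neq0.
  - rewrite (bigD1 i)//= ai mulr0 add0r big1// => j /negPf ->.
    by rewrite mul0r.
have ki : (k == i) = false by rewrite eq_sym; exact: negPf.
exists (fun j => if j == i then alpha k else if j == k then - alpha i else 0).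
split.
- by move=> j; case: (j == i) => //; case: (j == k) => //; rewrite eqxx.
- by exists k; rewrite ki eqxx oppr_eq0.
- rewrite (bigD1 i)//= eqxx (bigD1 k) ?ki//= eqxx.
  rewrite big1; first by ring.
  by move=> j /andP[/negPf -> /negPf ->]; rewrite mul0r.
Qed.

(** * Induction on the interval and on the number of fractional exponents *)

Lemma hbl_between_maximizer s U V W :
    (forall U' V' : {group gT}, U' \subset V' ->
       (#|V'| - #|U'| < #|V| - #|U|)%N -> hbl_between s U' V') ->
    ratio_maximizer s U V W -> W != U -> W != V ->
  hbl_between s U V.
Proof.
move=> IH [UW WV Wmax] WU WV'.
have proper_card_lt (H K : {group gT}) :
    H \subset K -> H != K -> (#|H| < #|K|)%N.
  move=> HK HneK; rewrite (ltn_leqif (subset_leqif_cards HK)).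
  by apply: contra HneK => /eqP e; apply/eqP/val_inj.
have ltUW : (#|U| < #|W|)%N by rewrite proper_card_lt// eq_sym.
have ltWV : (#|W| < #|V|)%N by exact: proper_card_lt.
apply: (hbl_between_factor UW WV).
- by move=> K UK KV; rewrite !subgroup_ratioE ler_expR Wmax.
- by apply: IH => //; apply: ltn_sub2r => //; exact: ltn_trans ltWV.
- by apply: IH => //; apply: ltn_sub2l => //; exact: ltn_trans ltWV.
Qed.

(** If some [s i = 1] with [phi_i(V)] not contained in [phi_i(U)], the subgroup
    of [hbl_between_exponent1] is proper in [V] and the induction hypothesis
    applies to it; if there is none, this is the base case. *)
Lemma hbl_between_one_fractional s U V i0 :
    (forall U' V' : {group gT}, U' \subset V' ->
       (#|V'| - #|U'| < #|V| - #|U|)%N -> hbl_between s U' V') ->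
    (forall j, 0 <= s j <= 1) -> U \subset V ->
    (forall j, j != i0 -> j \notin fractional s) ->
  hbl_between s U V.
Proof.
move=> IH s01 UV frac.
have s0 j : 0 <= s j by case/andP: (s01 j).
have [/existsP[i /and3P[_ /eqP si imgi]]|] := boolP
    [exists i, [&& i != i0, s i == 1 & ~~ (img i V \subset img i U)]].
  apply: (hbl_between_exponent1 s0 si UV).
  set K := (V :&: _)%G.
  have UK : U \subset K.
    rewrite finset.subsetI UV; apply/fintype.subsetP => x xU.
    by rewrite !inE mem_morphim ?inE.
  apply: IH => //; apply: ltn_sub2r.
    apply: proper_card; rewrite properE UV; apply: contra imgi => VU.
    exact: morphimS.
  apply: proper_card; rewrite properE subsetIl; apply: contra imgi.
  rewrite finset.subsetI => /andP[_] /(morphimS (phi i)) /fintype.subset_trans.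
  apply; apply/fintype.subsetP => _ /morphimP[x _ + ->].
  by rewrite !inE.
rewrite negb_exists => /forallP triv.
apply: (@hbl_between_base s U V i0) => // j ji0.
have := triv j; rewrite ji0 /= negb_and negbK => triv_j.
have := frac j ji0; rewrite inE negb_and; have /andP[sj0 sj1] := s01 j.
rewrite !lt_def sj0 sj1 !andbT !negbK => /orP[/eqP ->|/eqP sj]; first by left.
by right; move: triv_j; rewrite -sj eqxx.
Qed.

(** The index [i0] only ensures that there is some index to single out in the
    base case. *)
Lemma hbl_between_subgroups s U V (i0 : I) :
  (forall j, 0 <= s j <= 1) -> U \subset V -> hbl_between s U V.
Proof.
(* Outer induction on [#|V| - #|U|], inner induction on [#|fractional s|]. *)
have [n] := ubnP (#|V| - #|U|)%N; elim: n s U V => // n IHn s U V.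
rewrite ltnS => UVn; have [k] := ubnP #|fractional s|.
elim: k s => // k IHk s; rewrite ltnS => sk s01 UV.
have IH s' : (forall j, 0 <= s' j <= 1) ->
    forall U' V' : {group gT}, U' \subset V' ->
    (#|V'| - #|U'| < #|V| - #|U|)%N -> hbl_between s' U' V'.
  by move=> s'01 U' V' UV' lt'; apply: IHn => //; exact: leq_trans lt' UVn.
pose between := [pred H : {group gT} | (U \subset H) && (H \subset V)].
have betweenU : between U by rewrite /= fintype.subxx.
have [W /andP[UW WV] Wmax] := @arg_maxP _ _ _ U between (log_ratio s) betweenU.
have maxW : ratio_maximizer s U V W.
  by split=> // H UH HV; apply: Wmax; rewrite /= UH.
have [/existsP[H /and5P[UH HV HU HV' /eqP HW]]|none] := boolP
    [exists H : {group gT}, [&& U \subset H, H \subset V, H != U, H != V &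
       log_ratio s H == log_ratio s W]].
  apply: (hbl_between_maximizer (IH s s01) _ HU HV').
  by split=> // K UK KV; rewrite HW; case: maxW => _ _; apply.
have strict H : U \subset H -> H \subset V -> H != U -> H != V ->
    log_ratio s H < log_ratio s W.
  move=> UH HV HU HV'; rewrite lt_neqAle; apply/andP; split; last first.
    by case: maxW => _ _; apply.
  apply: contra none => HW; apply/existsP; exists H.
  by rewrite UH HV HU HV'.
have WUV : W = U \/ W = V.
  have [->|WU] := eqVneq W U; first by left.
  have [->|WV'] := eqVneq W V; first by right.
  by have := strict W UW WV WU WV'; rewrite ltxx.
have [/card_gt1P[i [j [si sj ij]]]|frac1] := ltnP 1 #|fractional s|; last first.
  have [i si_only] : exists i, forall j, j != i -> j \notin fractional s.
    have [f0|[i si]] := set_0Vmem (fractional s).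
      by exists i0 => j _; rewrite f0 inE.
    exists i => j ji; apply: contraL frac1 => sj; rewrite -ltnNge.
    by apply/card_gt1P; exists j, i.
  by apply: (hbl_between_one_fractional (IH s s01) s01 UV) => //; exact: si_only.
(* Along a direction [d] with [sum_j d j * alpha j = 0] the ratios of [U] and
   [V] change by the same factor. *)
pose alpha l := ln #|img l U|%:R - ln #|img l V|%:R : R.
have [d [dij [l dl] dalpha]] := two_point_kernel alpha ij.
have frac (e : I -> R) : (forall j, e j != 0 -> d j != 0) ->
    forall j, e j != 0 -> j \in fractional s.
  by move=> ed m /ed /dij /orP[] /eqP ->.
have slope (e : I -> R) : \sum_j e j * alpha j = 0 ->
    \sum_j e j * ln #|img j U|%:R = \sum_j e j * ln #|img j V|%:R :> R.
  move=> e0; apply/eqP; rewrite -subr_eq0 -sumrB -[X in _ == X]e0.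
  by apply/eqP; apply: eq_bigr => m _; rewrite mulrBr.
have slide (e : I -> R) :
    (forall j, e j != 0 -> d j != 0) -> (exists j, e j != 0) ->
    \sum_j e j * alpha j = 0 ->
    exists2 t, 0 < t & let s' := fun j => s j + t * e j in
    [/\ forall j, 0 <= s' j <= 1, ratio_maximizer s' U V W &
        hbl_between s' U V].
  move=> ed e0 ealpha.
  have [t t0 /= [s'01 s'W hit]] :=
    slide_to_boundary s01 maxW WUV strict (frac e ed) e0 (slope e ealpha).
  exists t => //; split=> //; case: hit => [[H [UH HV HU HV' HW]]|lt'].
    apply: (hbl_between_maximizer (IH _ s'01) _ HU HV').
    by split=> // K UK KV; rewrite HW; case: s'W => _ _; apply.
  by apply: IHk => //; exact: leq_trans lt' sk.
have [t1 t1_gt0 [s1_01 max1 hbl1]] :=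
  slide d (fun _ => id) (ex_intro _ l dl) dalpha.
have [|||t2 t2_gt0 [s2_01 max2 hbl2]] := slide (fun j => - d j).
- by move=> m; rewrite oppr_eq0.
- by exists l; rewrite oppr_eq0.
- rewrite -[RHS]oppr0 -[in RHS]dalpha -sumrN.
  by apply: eq_bigr => m _; rewrite mulNr.
(* [s] divides the segment from [s + t1 * d] to [s - t2 * d] in the ratio
   [t1 : t2]. *)
have t12 : 0 < t1 + t2 by rewrite addr_gt0.
apply: (hbl_between_interpolate (t := t2 / (t1 + t2)) _ _ _ _ max1 max2 hbl1 hbl2).
- by rewrite divr_gt0//= ltr_pdivrMr// mul1r ltrDr.
- by move=> m; case/andP: (s1_01 m).
- by move=> m; case/andP: (s2_01 m).
- by move=> m; field; rewrite gt_eqF.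
Qed.

End SubgroupIntervals.

(** * From subgroup intervals to the datum *)

Section Datum.
Variables (R : realType) (D : finite_hbl_datum).
Local Notation m := (hbl_m D).
Implicit Types (s : 'I_m -> R) (H : {group hbl_G D}).

Lemma hbl_phi_morphic (j : 'I_m) :
  {in [set: hbl_G D] &, {morph hbl_phi j : x y / (x * y)%g}}.
Proof. by move=> x y _ _; exact: raddfD. Qed.

Definition hbl_phi_morphism (j : 'I_m) := Morphism (@hbl_phi_morphic j).

Lemma subgroup_ratio_hbl s H :
  subgroup_ratio hbl_phi_morphism s H = hbl_A_sub H s.
Proof.
congr (_ * _); apply: eq_bigr => j _; congr (_%:R `^ _).
by rewrite morphimEsub ?finset.subsetT.
Qed.

Lemma counting_norm_pos (T : finType) (r : R) (f : T -> R) : r != 0 ->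
  counting_norm (r%:E^-1)%E f = (\sum_x `|f x| `^ r^-1) `^ r.
Proof. by move=> r0; rewrite inver (negPf r0)/= invrK. Qed.

Lemma le_counting_norm_infty (T : finType) (f : T -> R) (y : T) :
  `|f y| <= counting_norm (0%:E^-1)%E f.
Proof.
rewrite inver eqxx /=; apply: ub_le_sup; last by exists y.
exists (\sum_x `|f x|) => _ [x _ <-].
by rewrite (bigD1 x)//= lerDl sumr_ge0.
Qed.

Lemma counting_norm_infty_le (T : finType) (f : T -> R) (c : R) (y : T) :
  (forall x, `|f x| <= c) -> counting_norm (0%:E^-1)%E f <= c.
Proof.
move=> fc; rewrite inver eqxx /=; apply: ge_sup; first by exists `|f y|, y.
by move=> _ [x _ <-].
Qed.

Lemma counting_norm_ge0 (T : finType) (r : R) (f : T -> R) (y : T) :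
  0 <= counting_norm (r%:E^-1)%E f.
Proof.
have [->|r0] := eqVneq r 0; last by rewrite counting_norm_pos// powR_ge0.
exact: le_trans (le_counting_norm_infty f y).
Qed.

(** Each [f j] is written as [c j * h j ^ s_j]: for [s_j > 0] with [c j = 1] and
    [h j = f j ^ (1 / s_j)], whose sum to the power [s_j] is the norm of [f j];
    for [s_j = 0] with [h j = 1] and [c j] the supremum norm. *)
Lemma hbl_ineq_of_bound s (C : R) : (forall j, 0 <= s j <= 1) ->
  (forall H, hbl_A_sub H s <= C) -> hbl_ineq s C%:E.
Proof.
move=> s01 hC f f0.
have s0 j : 0 <= s j by case/andP: (s01 j).
pose c j := if s j == 0 then counting_norm ((s j)%:E^-1)%E (f j) else 1.
pose h j y := if s j == 0 then 1 else f j y `^ (s j)^-1.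
have c0 j : 0 <= c j.
  by rewrite /c; case: ifP => // _; exact: (counting_norm_ge0 _ _ 0).
have h0 j y : 0 <= h j y by rewrite /h; case: ifP => // _; exact: powR_ge0.
have f_le j y : f j y <= c j * h j y `^ s j.
  rewrite /c /h; have [sj|sj] := eqVneq (s j) 0.
    by rewrite powR1 mulr1 sj -[leLHS]ger0_norm ?le_counting_norm_infty.
  by rewrite mul1r -powRrM mulVf// powRr1.
have norm_ge j (B : {set hbl_Gj j}) :
    c j * (\sum_(y in B) h j y) `^ s j <= counting_norm ((s j)%:E^-1)%E (f j).
  rewrite /c /h; have [sj|sj] := eqVneq (s j) 0.
    by rewrite [X in _ `^ X]sj powRr0 mulr1.
  rewrite mul1r counting_norm_pos// ge0_ler_powR ?nnegrE ?sumr_ge0//.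
    by move=> y _; exact: powR_ge0.
  rewrite [leRHS](bigID [in B])/= -[leLHS]addr0 lerD ?sumr_ge0//.
  by apply: ler_sum => y _; rewrite ger0_norm.
have sub1 : [1 hbl_G D]%G \subset [set: hbl_G D]%G by exact: finset.subsetT.
have i0 : 'I_m := Ordinal (hbl_m_gt0 D).
have main : \sum_(x in [set: hbl_G D]) \prod_j h j (hbl_phi j x) `^ s j <=
    C * \prod_j (\sum_(y in (hbl_phi_morphism j @* [set: hbl_G D])%g) h j y) `^ s j.
  apply: (@hbl_between_subgroups _ _ _ _ hbl_phi_morphism _ _ _ i0 s01 sub1) => //.
    by move=> j y z /morphimP[x _ /set1P-> ->]; rewrite morph1 mulg1.
  by move=> H _ _; rewrite subgroup_ratio_hbl.
have C0 : 0 <= C.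
  apply: le_trans (hC [1 hbl_G D]%G).
  by rewrite -subgroup_ratio_hbl ltW ?subgroup_ratio_gt0.
rewrite -EFinM lee_fin.
apply: (@le_trans _ _ (\prod_j c j *
    (\sum_(x in [set: hbl_G D]) \prod_j h j (hbl_phi j x) `^ s j))).
  rewrite mulr_sumr (eq_bigl _ _ (fun x => finset.in_setT x)).
  apply: ler_sum => x _; rewrite -big_split/=.
  by apply: ler_prod => j _; rewrite f0 f_le.
apply: le_trans (ler_wpM2l _ main) _; first by apply: prodr_ge0.
rewrite mulrCA -big_split/= ler_wpM2l//.
apply: ler_prod => j _; rewrite mulr_ge0 ?powR_ge0//=.
Qed.

(** Test the inequality on the indicator functions of the images of [H]. *)
Lemma hbl_ineq_bound s (C : R) H : (forall j, 0 <= s j <= 1) ->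
  0 <= C -> hbl_ineq s C%:E -> hbl_A_sub H s <= C.
Proof.
move=> s01 C0 hC.
have s0 j : 0 <= s j by case/andP: (s01 j).
pose f j (y : hbl_Gj j) : R := (y \in hbl_phi j @: H)%:R.
have f0 j y : 0 <= f j y by exact: ler0n.
have := hC f f0; rewrite -EFinM lee_fin => fC.
have sum_ge : #|H|%:R <= \sum_(x : hbl_G D) \prod_(j < m) f j (hbl_phi j x).
  rewrite [leRHS](bigID [in H])/= -[leLHS]addr0 lerD//; last first.
    by apply: sumr_ge0 => x _; apply: prodr_ge0.
  rewrite -sum1_card natr_sum; apply: ler_sum => x xH.
  by rewrite big1// => j _; rewrite /f imset_f.
have img0 j : 0 < #|hbl_phi j @: H|%:R :> R.
  by rewrite ltr0n card_gt0; apply/set0Pn; exists (hbl_phi j 1%g); rewrite imset_f.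
have norm_le j : counting_norm ((s j)%:E^-1)%E (f j) <=
    #|hbl_phi j @: H|%:R `^ s j.
  have [->|sj] := eqVneq (s j) 0.
    rewrite powRr0; apply: (counting_norm_infty_le 0) => x.
    by rewrite ger0_norm// lern1 leq_b1.
  rewrite counting_norm_pos// le_eqVlt; apply/orP; left; apply/eqP.
  congr (_ `^ _); rewrite -sum1_card natr_sum.
  rewrite [RHS]big_mkcond/=; apply: eq_bigr => y _.
  rewrite /f; case: (y \in _).
    by rewrite normr1 powR1.
  by rewrite normr0 powR0// invr_eq0.
rewrite /hbl_A_sub; under eq_bigr do rewrite powRN.
rewrite prodfV ler_pdivrMr; last by apply: prodr_gt0 => j _; rewrite powR_gt0.
apply: le_trans sum_ge (le_trans fC _).
rewrite ler_wpM2l//; apply: ler_prod => j _; rewrite norm_le andbT.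
exact: (counting_norm_ge0 _ _ 0).
Qed.

End Datum.

Theorem theorem1p1 (R : realType) (D : finite_hbl_datum)
    (s : 'I_(hbl_m D) -> R)
    (hs : forall j : 'I_(hbl_m D), 0 <= s j <= 1) :
  hbl_B s = hbl_A s.
Proof.
apply/eqP; rewrite eq_le; apply/andP; split; last first.
  apply: ge_ereal_sup => _ [H _ <-]; apply: le_ereal_inf_tmp => C [C0 hC].
  case: C C0 hC => [C C0 hC|_ _|]; [|exact: leey|by rewrite leeNy_eq].
  by rewrite lee_fin; apply: (hbl_ineq_bound _ hs _ hC); rewrite -lee_fin.
have [W _ Wmax] := @arg_maxP _ _ {group hbl_G D} [1 hbl_G D]%G predT
  (fun H => hbl_A_sub H s) isT.
apply: (@le_trans _ _ (hbl_A_sub W s)%:E).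
  apply: ereal_inf_lbound; split.
    by rewrite lee_fin -subgroup_ratio_hbl ltW// subgroup_ratio_gt0.
  by apply: hbl_ineq_of_bound => // H; exact: Wmax.
by apply: ereal_sup_ubound; exists W.
Qed.
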